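(* Let $\vec{S}_4$ be the directed graph on vertex set $\{1,2,3,4\}$ with arc set $\{\vec{12},\vec{13},\vec{14}\}$. Then \[\pi_{\vec{S}_4}(\emptyset)=\frac{4p(1-p)^3}{1-p^4},\] where $p$ is the real root of $3t^3+3t^2+3t-1$.
   Context: A directed graph is a pair $(V,E)$ with $E$ a set of ordered pairs $\vec{xy}$ of distinct vertices. A set $S\subseteq V$ induces a copy of a directed graph $H$ if the directed graph on $S$ consisting of all arcs of $E$ with both ends in $S$ is isomorphic to $H$. For a directed graph $H$ on $h$ vertices, $\pi_H(\emptyset)=\lim_{n\to\infty}\max_D e_H(D)/\binom{n}{h}$, where the maximum is over directed graphs $D$ on $n$ vertices and $e_H(D)$ counts the $h$-subsets of $V(D)$ inducing a copy of $H$ (the limit exists). *)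

(* Defs.v *)
From HB Require Import structures.
From mathcomp Require Import all_boot all_order all_algebra.
From mathcomp Require Import all_classical all_reals all_analysis.

Set Implicit Arguments.
Unset Strict Implicit.
Unset Printing Implicit Defensive.

Import Order.TTheory GRing.Theory Num.Theory.
Import numFieldNormedType.Exports.

Local Open Scope ring_scope.

(* Arcs are ordered pairs of distinct vertices; both (x, y) and (y, x) may be
   present. *)
Record digraph (V : finType) := Digraph {
  arcs : {set V * V};
  _ : [forall x, (x, x) \notin arcs] }.

HB.instance Definition _ (V : finType) := [isSub for @arcs V].
HB.instance Definition _ (V : finType) := [Finite of digraph V by <:].

Lemma arcs_irr (V : finType) (D : digraph V) (x : V) : (x, x) \notin arcs D.
Proof. by case: D => E /= /forallP. Qed.

Definition iso_digraph (U W : finType) (H : digraph U) (G : digraph W) : bool :=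
  [exists f : {ffun U -> W},
     [&& injectiveb f, [forall w, exists u, f u == w] &
       [forall x, forall y, ((f x, f y) \in arcs G) == ((x, y) \in arcs H)]]].

Definition induced_arcs (V : finType) (D : digraph V) (S : {set V}) :
    {set {x : V | x \in S} * {x : V | x \in S}} :=
  [set a | (val a.1, val a.2) \in arcs D].

Lemma induced_arcs_irr (V : finType) (D : digraph V) (S : {set V}) :
  [forall x, (x, x) \notin induced_arcs D S].
Proof. by apply/forallP => x; rewrite inE /= arcs_irr. Qed.

Definition induced (V : finType) (D : digraph V) (S : {set V}) :
    digraph {x : V | x \in S} := Digraph (induced_arcs_irr D S).

Definition num_induced (U V : finType) (H : digraph U) (D : digraph V) : nat :=
  #|[set S : {set V} | (#|S| == #|U|) && iso_digraph H (induced D S)]|.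

(* The value is 0 for n < #|U|, where the binomial coefficient vanishes. *)
Definition max_density (R : realType) (U : finType) (H : digraph U) (n : nat) : R :=
  (\max_(D : digraph 'I_n) num_induced H D)%:R / 'C(n, #|U|)%:R.

(* [lim] is meaningful only when [max_density R H] converges. *)
Definition pi_induced (R : realType) (U : finType) (H : digraph U) : R :=
  lim (max_density R H n @[n --> \oo])%classic.

(* The vertices 1, 2, 3, 4 are renumbered 0, 1, 2, 3. *)
Definition outstar4_arcs : {set 'I_4 * 'I_4} :=
  [set a | (val a.1, val a.2) \in [:: (0, 1); (0, 2); (0, 3)]%N].

Lemma outstar4_irr : [forall x, (x, x) \notin outstar4_arcs].
Proof. by apply/forallP => -[[|[|[|[|k]]]] kP]; rewrite inE. Qed.

Definition outstar4 : digraph 'I_4 := Digraph outstar4_irr.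

(* Main.v *)
Require Import Defs.
From mathcomp Require Import all_boot all_order all_algebra.
From mathcomp Require Import all_classical all_reals all_analysis.
From mathcomp Require Import ring lra.

(* Count quadruples (x, y, z, c) in which c strictly dominates x, y, z and the
   leaves x, y, z are pairwise non-adjacent, repetitions allowed; up to O(n^3)
   this is 6 times the number of induced stars.  Give the vertices weights.
   Along a transfer of weight between two non-adjacent vertices u and v the
   weighted count is at most the larger of its two end values, so the weight can
   be concentrated on a set of pairwise adjacent vertices.  The three leaves
   then coincide and the count is the sum of w c * w x ^ 3 over strict arcs
   (c, x).  Splitting off the heaviest vertex bounds it by K * W ^ 4, where W is
   the total weight and K satisfies q (1 - q)^3 + K q^4 <= K on [0, 1]; the least
   such K is attained at the root p of the cubic.  The bound is matched by the
   iterated construction in which the first p n vertices dominate an independent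
   set formed by the others, and carry the same construction. *)

Set Implicit Arguments.
Unset Strict Implicit.
Unset Printing Implicit Defensive.

Import Order.TTheory GRing.Theory Num.Theory.
Import numFieldNormedType.Exports.

Local Open Scope ring_scope.

(** * Weighted counts of stars *)

Section WeightedStars.
Variables (R : realFieldType) (V : finType) (a nadj : rel V).

Definition wsum (w f : V -> R) : R := \sum_x w x * f x.

Definition star4 (x y z c : V) : bool :=
  [&& a c x, a c y, a c z, nadj x y, nadj x z & nadj y z].

Definition star_weight (w : V -> R) : R :=
  wsum w (fun x => wsum w (fun y => wsum w (fun z => wsum w (fun c =>
    (star4 x y z c)%:R)))).

Lemma eq_wsum w f g : f =1 g -> wsum w f = wsum w g.
Proof. by move=> e; apply: eq_bigr => x _; rewrite e. Qed.

Lemma le_wsum w f g : (forall x, 0 <= w x) -> (forall x, f x <= g x) ->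
  wsum w f <= wsum w g.
Proof. by move=> w0 fg; apply: ler_sum => x _; apply: ler_wpM2l. Qed.

Lemma wsum_linear w f g (k l : R) :
  wsum w (fun x => k * f x + l * g x) = k * wsum w f + l * wsum w g.
Proof.
rewrite /wsum !mulr_sumr -big_split; apply: eq_bigr => x _ /=; ring.
Qed.

Definition transfer (w : V -> R) (u v x : V) : R :=
  if x == u then w u + w v else if x == v then 0 else w x.

(** * Transfer of weight between two non-adjacent vertices *)

Section Transfer.
Variables (w : V -> R) (u v : V).
Hypotheses (w0 : forall x, 0 <= w x) (neq_uv : u != v).

(** Choosing a vertex with weights [w] is choosing it with weights [wt] and then, if it is [u],
    keeping it with probability [lam] and replacing it by [v] otherwise. [mix f] is the mean of [f]
    over this second choice. If both weights vanish, [lam] is 0 by default, which does no harm. *)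
Let lam := w u / (w u + w v).
Let redir (x : V) := if x == u then v else x.
Let mix (f : V -> R) (x : V) := lam * f x + (1 - lam) * f (redir x).

Local Notation wt := (transfer w u v).

Lemma transfer_ge0 x : 0 <= wt x.
Proof. by rewrite /transfer; do 2?case: ifP => // _; rewrite addr_ge0. Qed.

Lemma wsum_transferE f :
  wsum wt f = (w u + w v) * f u + \sum_(x | (x != u) && (x != v)) w x * f x.
Proof.
rewrite /wsum (bigD1 u) //= (bigD1 v) 1?eq_sym //= /transfer eqxx.
rewrite eq_sym (negbTE neq_uv) eqxx mul0r add0r; congr (_ + _).
by apply: eq_bigr => x /andP[/negbTE-> /negbTE->].
Qed.

Let lamP : [/\ w u = lam * (w u + w v), w v = (1 - lam) * (w u + w v),
  0 <= lam & 0 <= 1 - lam].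
Proof.
have := w0 u; have := w0 v; rewrite /lam => v0 u0.
have [W0|W0] := eqVneq (w u + w v) 0.
  have -> : w u = 0 by lra.
  have -> : w v = 0 by lra.
  by split; rewrite ?mul0r ?mulr0 ?addr0 ?mulr0 //; lra.
have Wp : 0 < w u + w v by rewrite lt0r W0 addr_ge0.
split; [by field|by field|exact: divr_ge0 (ltW _)|].
have -> : 1 - w u / (w u + w v) = w v / (w u + w v) by field.
exact: divr_ge0 (ltW _).
Qed.

Lemma wsum_mix f : wsum w f = wsum wt (mix f).
Proof.
have [eu ev _ _] := lamP.
rewrite wsum_transferE /wsum (bigD1 u) //= (bigD1 v) 1?eq_sym //= addrA.
congr (_ + _).
  transitivity (lam * (w u + w v) * f u + (1 - lam) * (w u + w v) * f v).
    by rewrite -eu -ev.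
  by rewrite /mix /redir eqxx; ring.
by apply: eq_bigr => x /andP[/negbTE xu _]; rewrite /mix /redir xu; ring.
Qed.

Lemma mix_wsum (g : V -> V -> R) x : mix (fun x => wsum wt (g x)) x =
  wsum wt (fun y => mix (g^~ y) x).
Proof. by rewrite /mix wsum_linear. Qed.

Lemma eq_mix f g x : f =1 g -> mix f x = mix g x.
Proof. by move=> e; rewrite /mix !e. Qed.

Lemma mix_le f A x : (forall x', x' \in [:: x; redir x] -> f x' <= A) ->
  mix f x <= A.
Proof.
move=> fA; have [_ _ l0 l1] := lamP.
have := fA x (mem_head _ _); have := fA (redir x); rewrite !inE eqxx orbT => /(_ isT).
rewrite /mix => h1 h2.
have := ler_wpM2l l0 h2; have := ler_wpM2l l1 h1; lra.
Qed.

Lemma mix_le2 f A B x : f x <= A -> f (redir x) <= B ->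
  mix f x <= lam * A + (1 - lam) * B.
Proof. by move=> fA fB; have [_ _ l0 l1] := lamP; apply: lerD; apply: ler_wpM2l. Qed.

Lemma mix_fixed f x : x != u -> mix f x = f x.
Proof. by move=> xu; rewrite /mix /redir (negbTE xu); ring. Qed.

Hypotheses (nadjxx : reflexive nadj) (a_nadj : forall x y, a x y -> ~~ nadj x y).
Hypotheses (nadj_sym : symmetric nadj) (nadj_uv : nadj u v).

Local Ltac align ru auv avu axx nadjC leb :=
  apply: leb; rewrite ?ru /star4 ?auv ?avu ?axx ?andbF //;
  case/and5P => ? ? ? ? /andP[? ?]; do ?(apply/andP; split);
  first [done | exact: nadjxx | exact: nadjC].

(* If some coordinate is [u], every choice between [u] and [v] in the other
   coordinates that gives a star still gives one once these coordinates are
   aligned with that one. *)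
Lemma mix_star4_le x y z c :
  mix (fun x' => mix (fun y' => mix (fun z' => mix (fun c' =>
    (star4 x' y' z' c')%:R) c) z) y) x
  <= lam * (star4 x y z c)%:R
     + (1 - lam) * (star4 (redir x) (redir y) (redir z) (redir c))%:R.
Proof.
have vu : nadj v u by rewrite nadj_sym.
have auv : a u v = false by apply/negP => /a_nadj; rewrite nadj_uv.
have avu : a v u = false by apply/negP => /a_nadj; rewrite vu.
have axx t : a t t = false by apply/negP => /a_nadj; rewrite nadjxx.
have leb (b b' : bool) : (b -> b') -> b%:R <= b'%:R :> R.
  by move=> h; rewrite ler_nat; case: b h => // ->.
have redirP t t' : t' \in [:: t; redir t] ->
    [\/ t = u /\ t' = u, t = u /\ t' = v | redir t = t /\ t' = t].
  rewrite !inE /redir; have [->|_] := eqVneq t u => /orP[] /eqP->.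
  - by constructor 1.
  - by constructor 2.
  - by constructor 3.
  - by constructor 3.
have ru : redir u = v by rewrite /redir eqxx.
have nadjC t t' : nadj t t' -> nadj t' t by rewrite nadj_sym.
(* Case on the first coordinate equal to [u]. Its own choice yields the two terms on the right; the
   later choices are bounded by their best outcome, and the earlier coordinates are not affected by
   [mix]. *)
have [->|xu] := eqVneq x u.
  by apply: mix_le2; do 3 (apply: mix_le => ? /redirP[] [e ->]; rewrite ?e {e});
    align ru auv avu axx nadjC leb.
rewrite mix_fixed //.
have rx : redir x = x by rewrite /redir (negbTE xu).
rewrite rx; have [->|yu] := eqVneq y u.
  by apply: mix_le2; do 2 (apply: mix_le => ? /redirP[] [e ->]; rewrite ?e {e});
    align ru auv avu axx nadjC leb.
rewrite mix_fixed //.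
have ry : redir y = y by rewrite /redir (negbTE yu).
rewrite ry; have [->|zu] := eqVneq z u.
  by apply: mix_le2; apply: mix_le => ? /redirP[] [e ->]; rewrite ?e {e};
    align ru auv avu axx nadjC leb.
rewrite mix_fixed //.
have rz : redir z = z by rewrite /redir (negbTE zu).
by rewrite rz /mix.
Qed.

(** Each of the four sums is turned into a [wt]-sum of a [mix], and the [mix] is moved inwards by
    linearity until it meets the indicator. There the four independent choices between [u] and [v]
    give way to one choice common to all coordinates. *)
Lemma star_weight_mix_le : star_weight w <=
  lam * star_weight wt + (1 - lam) *
    wsum wt (fun x => wsum wt (fun y => wsum wt (fun z =>
      wsum wt (fun c =>
       (star4 (redir x) (redir y) (redir z) (redir c))%:R)))).
Proof.
rewrite /star_weight -wsum_linear wsum_mix.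
under eq_wsum => x do rewrite (eq_mix _ (fun x => wsum_mix _)) mix_wsum.
apply: le_wsum => [|x]; first exact: transfer_ge0.
rewrite -wsum_linear.
under eq_wsum => y do rewrite (eq_mix _ (fun x => eq_mix _ (fun y => wsum_mix _)))
  (eq_mix _ (fun x => mix_wsum _ _)) mix_wsum.
apply: le_wsum => [|y]; first exact: transfer_ge0.
rewrite -wsum_linear.
under eq_wsum => z do rewrite (eq_mix _ (fun x => eq_mix _ (fun y => eq_mix _ (fun z => wsum_mix _))))
  (eq_mix _ (fun x => eq_mix _ (fun y => mix_wsum _ _))) (eq_mix _ (fun x => mix_wsum _ _)) mix_wsum.
apply: le_wsum => [|z]; first exact: transfer_ge0.
rewrite -wsum_linear.
apply: le_wsum => [|c]; [exact: transfer_ge0|exact: mix_star4_le].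
Qed.

(** Redirecting [u] to [v] pushes the weights [wt] forward to those of the opposite transfer. *)
Lemma wsum_redir f : wsum wt (fun x => f (redir x)) = wsum (transfer w v u) f.
Proof.
rewrite wsum_transferE [RHS]/wsum [RHS](bigD1 v) //= [in RHS](bigD1 u) //=.
rewrite /transfer /redir !eqxx (negbTE neq_uv) mul0r add0r [w v + _]addrC.
congr (_ + _).
apply: eq_big => [x|x /andP[/negbTE xu /negbTE xv]]; first by rewrite andbC.
by rewrite xu xv.
Qed.

(** The bound with a common choice is a convex combination of the star weights of the two opposite
    transfers. *)
Lemma star_weight_transfer :
  star_weight w <= Num.max (star_weight wt) (star_weight (transfer w v u)).
Proof.
have [_ _ l0 l1] := lamP.
apply: le_trans star_weight_mix_le _.
rewrite (wsum_redir (fun x => wsum wt (fun y => wsum wt (fun z =>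
  wsum wt (fun c => (star4 x (redir y) (redir z) (redir c))%:R))))).
under eq_wsum => x do rewrite (wsum_redir (fun y => wsum wt (fun z =>
  wsum wt (fun c => (star4 x y (redir z) (redir c))%:R)))).
under eq_wsum => x do under eq_wsum => y do rewrite (wsum_redir (fun z =>
  wsum wt (fun c => (star4 x y z (redir c))%:R))).
under eq_wsum => x do under eq_wsum => y do under eq_wsum => z do
  rewrite (wsum_redir (fun c => (star4 x y z c)%:R)).
rewrite -/(star_weight _).
set A := star_weight _; set B := star_weight _.
have hA : A <= Num.max A B by rewrite le_max lexx.
have hB : B <= Num.max A B by rewrite le_max lexx orbT.
have := ler_wpM2l l0 hA; have := ler_wpM2l l1 hB; lra.
Qed.

Lemma sum_transfer : \sum_x wt x = \sum_x w x.
Proof.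
have := wsum_transferE (fun=> 1); rewrite /wsum.
under eq_bigr => x _ do rewrite mulr1.
under [in X in _ = _ + X -> _]eq_bigr => x _ do rewrite mulr1.
by move=> ->; rewrite mulr1 [RHS](bigD1 u) //= [in RHS](bigD1 v) 1?eq_sym //= addrA.
Qed.

End Transfer.

(** * Upper bound for the weighted count by concentration on a clique *)

Section CliqueSupport.
Variable K : R.
Hypothesis K_ge : forall q : R, 0 <= q <= 1 -> q * (1 - q) ^+ 3 + K * q ^+ 4 <= K.
Hypothesis a_anti : forall x y, a x y -> ~~ a y x.

(** Homogeneous form of [K_ge], with [q = s / (s + t)]: below, [t] is the weight of one leaf class
    and [s] that of all other vertices. *)
Let K_ge_hom (s t : R) : 0 <= s -> 0 <= t ->
  s * t ^+ 3 + K * s ^+ 4 <= K * (s + t) ^+ 4.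
Proof.
move=> s0 t0; have [W0|W0] := eqVneq (s + t) 0.
  have -> : s = 0 by lra.
  have -> : t = 0 by lra.
  by rewrite !expr0n /= !addr0 expr0n !mulr0 addr0.
have Wp : 0 < s + t by rewrite lt0r W0 addr_ge0.
have q01 : 0 <= s / (s + t) <= 1.
  by rewrite divr_ge0 ?(ltW Wp) //= ler_pdivrMr // mul1r lerDl.
have := ler_wpM2r (exprn_ge0 4 (ltW Wp)) (K_ge q01).
suff -> : (s / (s + t) * (1 - s / (s + t)) ^+ 3 + K * (s / (s + t)) ^+ 4)
  * (s + t) ^+ 4 = s * t ^+ 3 + K * s ^+ 4 by [].
by field.
Qed.

(* The heaviest vertex [m] is best used as a leaf class: each of the other
   vertices [c] contributes at most [w c * w m ^+ 3] together with it. *)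
Lemma tournament_weight_le (w : V -> R) (S : {set V}) : (forall x, 0 <= w x) ->
  \sum_(x in S) \sum_(c in S) w c * w x ^+ 3 * (a c x)%:R
    <= K * (\sum_(x in S) w x) ^+ 4.
Proof.
move=> w0; have [k] := ubnP #|S|; elim: k S => // k IH S Sk.
have K0 : 0 <= K by have := K_ge (q := 0); rewrite !lexx ler01 => /(_ isT); lra.
have [->|[x0 x0S]] := set_0Vmem S.
  by rewrite !big_set0 expr0n mulr0.
have [m mS' mmax] := @arg_maxP _ R V x0 (mem S) w x0S.
have mS : m \in S by [].
have Sm : (#|S :\ m| < k)%N by move: Sk; rewrite (cardsD1 m S) mS.
have axx t : a t t = false by apply/negP => h; have := a_anti h; rewrite h.
have W0 : 0 <= \sum_(x in S :\ m) w x by apply: sumr_ge0.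
rewrite (big_setD1 m) //= (big_setD1 m mS) /= axx mulr0 add0r.
under [X in _ + X]eq_bigr => x xS do rewrite (big_setD1 m mS) /=.
rewrite big_split /= addrA -big_split /=.
rewrite (big_setD1 m mS) /= [w m + _]addrC.
apply: le_trans (K_ge_hom W0 (w0 m)).
apply: lerD; last exact: IH.
rewrite mulr_suml; apply: ler_sum => c; rewrite !inE => /andP[_ cS].
have le_cm : w c <= w m by exact: mmax.
(* Reversing an arc from [m] to a lighter vertex [c] does not decrease its contribution. *)
have swap : w m * w c ^+ 3 <= w c * w m ^+ 3.
  have -> : w m * w c ^+ 3 = w c * w m * w c ^+ 2 by ring.
  have -> : w c * w m ^+ 3 = w c * w m * w m ^+ 2 by ring.
  by rewrite ler_wpM2l ?mulr_ge0 // lerXn2r ?nnegrE.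
case acm: (a c m); case amc: (a m c).
- by have := a_anti acm; rewrite amc.
- by rewrite mulr1 mulr0 addr0.
- by rewrite mulr1 mulr0 add0r.
- by rewrite !mulr0 addr0 mulr_ge0 ?exprn_ge0.
Qed.

Hypotheses (nadjxx : reflexive nadj) (a_nadj : forall x y, a x y -> ~~ nadj x y).
Hypothesis nadj_sym : symmetric nadj.

Lemma star_weight_clique (w : V -> R) (S : {set V}) :
    (forall x, x \notin S -> w x = 0) ->
    {in S &, forall x y, nadj x y -> x = y} ->
  star_weight w = \sum_(x in S) \sum_(c in S) w c * w x ^+ 3 * (a c x)%:R.
Proof.
move=> wS cl.
have wsumS f : wsum w f = \sum_(x in S) w x * f x.
  rewrite /wsum (bigID (mem S)) /= [X in _ + X]big1 ?addr0 // => x xS.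
  by rewrite wS ?mul0r.
have wsum1 f x : x \in S -> (forall y, y \in S -> y != x -> f y = 0) ->
    wsum w f = w x * f x.
  move=> xS f0; rewrite wsumS (bigD1 x) //= big1 ?addr0 // => y /andP[yS yx].
  by rewrite f0 ?mulr0.
rewrite /star_weight wsumS; apply: eq_bigr => x xS.
rewrite (wsum1 _ x) //; last first.
  move=> y yS yx; rewrite /wsum big1 // => z _; rewrite big1 ?mulr0 // => c _.
  rewrite /star4; case: (boolP (nadj x y)) => [/cl e|_]; last by rewrite !andbF mulr0.
  by rewrite e ?eqxx in yx.
rewrite (wsum1 _ x) //; last first.
  move=> z zS zx; rewrite /wsum big1 // => c _.
  rewrite /star4; case: (boolP (nadj x z)) => [/cl e|_]; last by rewrite !andbF mulr0.
  by rewrite e ?eqxx in zx.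
rewrite wsumS !mulr_sumr; apply: eq_bigr => c cS.
by rewrite /star4 nadjxx !andbT !andbb; ring.
Qed.

(** Induction on the size of a set [S] containing the support. While [S] has two non-adjacent
    vertices, the better of the two transfers between them empties one, keeps the total weight and
    does not lower the star weight. When none are left, the tournament bound applies. *)
Theorem star_weight_le (w : V -> R) : (forall x, 0 <= w x) ->
  star_weight w <= K * (\sum_x w x) ^+ 4.
Proof.
move=> w0.
have : exists S : {set V}, forall x, x \notin S -> w x = 0.
  by exists [set: V]%SET => x; rewrite inE.
case=> S; have [k] := ubnP #|S|; elim: k S w w0 => // k IH S w w0 Sk wS.
case: (boolP [exists u in S, exists v in S, (u != v) && nadj u v]).
  case/exists_inP => u uS /exists_inP[v vS /andP[uv nuv]].
  have step u' v' : u' != v' -> u' \in S -> v' \in S ->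
      star_weight (transfer w u' v') <= K * (\sum_x w x) ^+ 4.
    move=> uv' uS' vS'; rewrite -(sum_transfer w uv').
    apply: (IH (S :\ v')) => [x||x].
    - exact: transfer_ge0.
    - by move: Sk; rewrite (cardsD1 v' S) vS'.
    - rewrite !inE negb_and negbK /transfer.
      have [->|xu] := eqVneq x u'; first by rewrite uS' orbF (negbTE uv').
      by have [//|xv] := eqVneq x v'; move/wS.
  apply: le_trans (star_weight_transfer w0 uv nadjxx a_nadj nadj_sym nuv) _.
  by rewrite ge_max !step // eq_sym.
move=> cl; rewrite (star_weight_clique wS).
  rewrite [X in _ <= K * X ^+ 4](bigID (mem S)) /= [X in _ + X]big1 ?addr0.
    exact: tournament_weight_le.
  by move=> x /wS.
move=> x y xS yS nxy; apply/eqP/negPn/negP => xy; case/negP: cl.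
by apply/exists_inP; exists x => //; apply/exists_inP; exists y => //; rewrite xy.
Qed.

End CliqueSupport.
End WeightedStars.

(** * Induced stars and quadruples of vertices *)

Section CountingStars.
Variables (V : finType) (D : digraph V).

(** All arcs of an induced star are one-way, so a pair joined in both directions must be neither
    [sarc] nor [indep]. *)
Definition sarc (x y : V) : bool := ((x, y) \in arcs D) && ((y, x) \notin arcs D).
Definition indep (x y : V) : bool :=
  ((x, y) \notin arcs D) && ((y, x) \notin arcs D).

Lemma indepxx : reflexive indep.
Proof. by move=> x; rewrite /indep arcs_irr. Qed.

Lemma indep_sym : symmetric indep.
Proof. by move=> x y; rewrite /indep andbC. Qed.

Lemma sarc_indep x y : sarc x y -> ~~ indep x y.
Proof. by move=> /andP[xy _]; rewrite /indep xy. Qed.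

Lemma sarc_anti x y : sarc x y -> ~~ sarc y x.
Proof. by move=> /andP[xy _]; rewrite /sarc xy andbF. Qed.

Definition dstar (t : V * V * V * V) : bool :=
  let: (x, y, z, c) := t in
  star4 sarc indep x y z c && [&& x != y, x != z & y != z].

Definition tset (t : V * V * V * V) : {set V} :=
  let: (x, y, z, c) := t in [set c; x; y; z]%SET.

Lemma dstar_uniq x y z c : dstar (x, y, z, c) -> uniq [:: c; x; y; z].
Proof.
case/andP=> /and5P[cx cy cz _ _] /and3P[xy xz yz] /=.
have ne u v : sarc u v -> u != v.
  by move=> h; apply/eqP => e; move: h; rewrite e /sarc (negbTE (arcs_irr _ _)).
by rewrite !inE !negb_or (ne _ _ cx) (ne _ _ cy) (ne _ _ cz) xy xz yz.
Qed.

Lemma tset_mem x y z c u : (u \in tset (x, y, z, c)) = (u \in [:: c; x; y; z]).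
Proof. by rewrite !inE -!orbA. Qed.

Lemma iso_outstar4P (S : {set V}) :
  reflect (exists2 t, dstar t & S = tset t)
    ((#|S| == #|{: 'I_4}|) && iso_digraph outstar4 (Defs.induced D S)).
Proof.
apply: (iffP idP) => [/andP[_]|[[[[x y] z] c] dt ->]].
  case/existsP => f /and3P[/injectiveP finj /forallP fsur /forallP farc].
  pose o i (h : (i < 4)%N) := Ordinal h.
  pose g i h := val (f (@o i h)).
  have garc i j hi hj : ((@g i hi, @g j hj) \in arcs D) =
      ((i, j) \in [:: (0, 1); (0, 2); (0, 3)]%N).
    by have /forallP/(_ (o j hj))/eqP := farc (o i hi); rewrite !inE /= => ->.
  have gneq i j hi hj : i != j -> @g i hi != @g j hj.
    by apply: contra => /eqP/val_inj/finj[->].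
  (* The image of vertex 0 is the centre, which comes last in a quadruple. *)
  exists (@g 1%N isT, @g 2%N isT, @g 3%N isT, @g 0%N isT).
    by rewrite /dstar /star4 /sarc /indep !garc !gneq.
  apply/setP => u; rewrite tset_mem !inE; apply/idP/idP.
    move=> uS; have /existsP[i /eqP/(congr1 val) /= <-] := fsur (exist _ u uS).
    case: i => [[|[|[|[|]]]] h] //; rewrite (bool_irrelevance h isT) /g /o eqxx ?orbT //.
  by case/or4P => /eqP->; exact: valP.
have un := dstar_uniq dt.
have cS : #|tset (x, y, z, c)| = 4%N.
  transitivity #|[:: c; x; y; z]|; last exact/card_uniqP.
  by apply: eq_card => u; rewrite tset_mem.
rewrite cS card_ord eqxx andTb; set S' := tset _.
have gS (i : 'I_4) : nth c [:: c; x; y; z] i \in S'.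
  by rewrite tset_mem mem_nth.
(* The isomorphism lists the centre first, then the three leaves. *)
apply/existsP; exists [ffun i => exist (fun u => u \in S') _ (gS i)]; apply/and3P; split.
- apply/injectiveP => i j; rewrite !ffunE => -[] /eqP.
  by rewrite nth_uniq // => /eqP/val_inj.
- apply/forallP => -[u uS]; apply/existsP.
  have uS' := uS; rewrite tset_mem in uS'.
  have hi : (index u [:: c; x; y; z] < 4)%N by rewrite index_mem.
  by exists (Ordinal hi); rewrite ffunE -val_eqE /= -/(nth c [:: c; x; y; z] _) nth_index.
case/andP: dt => /and5P[/andP[a1 b1] /andP[a2 b2] /andP[a3 b3] /andP[c1 c2]].
move=> /andP[/andP[c3 c4] /andP[c5 c6]] _.
apply/forallP => i; apply/forallP => j; rewrite !ffunE !inE /=.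
by case: i => -[|[|[|[|i]]]] // hi; case: j => -[|[|[|[|j]]]] //= hj;
  rewrite ?(negbTE (arcs_irr _ _)) ?a1 ?a2 ?a3 ?(negbTE b1) ?(negbTE b2) ?(negbTE b3)
    ?(negbTE c1) ?(negbTE c2) ?(negbTE c3) ?(negbTE c4) ?(negbTE c5) ?(negbTE c6).
Qed.

(** The vertex set determines the centre, and the three leaves can be listed in six orders. *)
Lemma card_dstar_fiber t : dstar t ->
  #|[set t' | dstar t' & tset t' == tset t]%SET| = 6%N.
Proof.
case: t => [[[x y] z] c] dt; have un := dstar_uniq dt.
pose s := [:: (x, y, z, c); (x, z, y, c); (y, x, z, c); (y, z, x, c);
  (z, x, y, c); (z, y, x, c)].
have us : uniq s.
  move: un; rewrite /s /= !inE !negb_or !xpair_eqE !eqxx !andbT.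
  by case/and3P => /and3P[_ _ _] /andP[/negbTE xy /negbTE xz] /negbTE yz;
   rewrite !(eq_sym y x) !(eq_sym z x) !(eq_sym z y) ?xy ?xz ?yz ?andbF.
transitivity #|s|; last exact/card_uniqP.
apply: eq_card => -[[[x' y'] z'] c']; rewrite inE; apply/andP/idP.
  case=> dt' /eqP e; have un' := dstar_uniq dt'.
  have mem u : (u \in [:: c'; x'; y'; z']) = (u \in [:: c; x; y; z]).
    by rewrite -!tset_mem e.
  (* Two different centres of the same set would each be a leaf of the other, hence dominate each
     other. *)
  have cc : c' = c.
    apply/eqP/negPn/negP => ne.
    have := mem c'; rewrite mem_head inE (negbTE ne) /= => /esym h1.
    have := mem c; rewrite mem_head inE eq_sym (negbTE ne) /= => h2.
    case/andP: dt => /and5P[cx cy cz _ _] _.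
    case/andP: dt' => /and5P[cx' cy' cz' _ _] _.
    have : sarc c c' by move: h1; rewrite !inE => /or3P[] /eqP->.
    apply/negP/sarc_anti.
    by move: h2; rewrite !inE => /or3P[] /eqP->.
  move: un' mem; rewrite cc /= !inE !negb_or.
  case/and4P => /and3P[cx' cy' cz'] /andP[xy' xz'] yz' _ mem.
  have := mem x'; have := mem y'; have := mem z'.
  rewrite !inE !eqxx ?orbT !(eq_sym _ c) (negbTE cx') (negbTE cy') (negbTE cz') /=.
  move=> /esym/or3P[] /eqP ez /esym/or3P[] /eqP ey /esym/or3P[] /eqP ex;
    move: xy' xz' yz'; rewrite ex ey ez ?eqxx // => _ _ _;
    by rewrite !xpair_eqE !eqxx ?orbT.
have sy u v : indep u v = indep v u by rewrite indep_sym.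
move=> h.
case/andP: dt => /and5P[cx cy cz nxy /andP[nxz nyz]] /and3P[xy xz yz].
split; last first.
  by apply/eqP/setP => u; move: h; rewrite !inE !xpair_eqE -!andbA =>
    /or4P[|||/or3P[]] /and4P[/eqP-> /eqP-> /eqP-> /eqP->];
    do 4!case: (u == _).
move: h; rewrite !inE !xpair_eqE -!andbA =>
    /or4P[|||/or3P[]] /and4P[/eqP-> /eqP-> /eqP-> /eqP->];
  by rewrite /dstar /star4 cx cy cz ?(eq_sym y x) ?(eq_sym z x) ?(eq_sym z y) ?xy ?xz ?yz
    ?nxy ?nxz ?nyz ?(sy y x) ?(sy z x) ?(sy z y) ?nxy ?nxz ?nyz.
Qed.

Lemma num_induced_outstar4 :
  (6 * num_induced outstar4 D = #|[set t | dstar t]%SET|)%N.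
Proof.
have -> : num_induced outstar4 D = #|tset @: [set t | dstar t]%SET|.
  apply: eq_card => S; rewrite inE; apply/iso_outstar4P/imsetP => [[t dt ->]|[t]].
    by exists t; rewrite ?inE.
  by rewrite inE => dt ->; exists t.
rewrite -[RHS]sum1_card (partition_big_imset tset) /= -sum1_card big_distrr /=.
apply: eq_bigr => S /imsetP[t]; rewrite inE => dt ->.
rewrite -(card_dstar_fiber dt) sum1dep_card muln1.
by apply: eq_card => t'; rewrite !inE.
Qed.

Definition star_count : nat :=
  (\sum_(x : V) \sum_(y : V) \sum_(z : V) \sum_(c : V) star4 sarc indep x y z c)%N.

Lemma star_weight1 (R : realFieldType) :
  star_weight sarc indep (fun=> 1 : R) = star_count%:R.
Proof.
rewrite /star_weight /wsum /star_count.
do 4 (rewrite natr_sum; apply: eq_bigr => ? _; rewrite mul1r).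
by [].
Qed.

Let card_dstarE : #|[set t | dstar t]%SET| =
  (\sum_x \sum_y \sum_z \sum_c dstar (x, y, z, c))%N.
Proof.
rewrite cardsE -sum1_card big_mkcond /= !pair_bigA /=.
by apply: eq_bigr => -[[[x y] z] c] _ /=; rewrite unfold_in; case: ifP => //= ->.
Qed.

Lemma num_induced_le_star_count : (6 * num_induced outstar4 D <= star_count)%N.
Proof.
rewrite num_induced_outstar4 card_dstarE.
do 4 (apply: leq_sum => ? _).
by rewrite /dstar; case: star4 => //=; case: andP.
Qed.

(** The surplus quadruples have two equal leaves. There are three pairs of leaf positions, and for
    each pair [#|V| ^ 3] quadruples agree there; [E] sums these coincidences. *)
Lemma star_count_le : (star_count <= 6 * num_induced outstar4 D + 3 * #|V| ^ 3)%N.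
Proof.
rewrite num_induced_outstar4 card_dstarE.
pose E := (\sum_(x : V) \sum_(y : V) \sum_(z : V) \sum_(c : V)
   ((x == y) + (x == z) + (y == z)))%N.
have sum1 (x : V) : (\sum_(y : V) (x == y) = 1)%N.
  by rewrite (bigD1 x) //= eqxx big1 // => y /negbTE; rewrite eq_sym => ->.
have -> : (3 * #|V| ^ 3 = E)%N.
  rewrite /E.
  under eq_bigr => x _ do under eq_bigr => y _ do under eq_bigr => z _ do
    rewrite sum_nat_const.
  under eq_bigr => x _ do under eq_bigr => y _ do
    rewrite -big_distrr /= !big_split /= !sum1 sum_nat_const.
  under eq_bigr => x _ do rewrite -big_distrr /= !big_split /= -big_distrr /= !sum1 !sum_nat_const.
  by rewrite sum_nat_const; ring.
rewrite /E -big_split; apply: leq_sum => x _; rewrite -big_split; apply: leq_sum => y _.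
rewrite -big_split; apply: leq_sum => z _; rewrite -big_split; apply: leq_sum => c _.
by rewrite /dstar; case: star4; case: (x == y); case: (x == z); case: (y == z).
Qed.

End CountingStars.

(** * The iterated construction *)

Lemma leq_sum_nat (m n : nat) (F G : nat -> nat) :
    (forall i, m <= i < n -> F i <= G i)%N ->
  (\sum_(m <= i < n) F i <= \sum_(m <= i < n) G i)%N.
Proof. by move=> FG; rewrite big_nat [leqRHS]big_nat; apply: leq_sum. Qed.

Section LevelDigraph.
Implicit Types (n m : nat) (l : nat -> nat).

(** The nested construction is encoded by one level per vertex: each level is an independent set
    dominated by all higher ones. Taking [l] on [nat] lets the same function serve for every [n]. *)
Definition level_arcs n l : {set 'I_n * 'I_n} :=
  [set a : 'I_n * 'I_n | (l a.2 < l a.1)%N]%SET.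

Lemma level_arcs_irr n l : [forall x, (x, x) \notin level_arcs n l].
Proof. by apply/forallP => x; rewrite inE /= ltnn. Qed.

Definition level_digraph n l : digraph 'I_n := Digraph (level_arcs_irr n l).

Definition level_star l (x y z c : nat) : bool :=
  [&& l x < l c, l y == l x & l z == l x]%N.

Definition level_count n l : nat :=
  (\sum_(0 <= x < n) \sum_(0 <= y < n) \sum_(0 <= z < n) \sum_(0 <= c < n)
     level_star l x y z c)%N.

Lemma star_count_level n l : star_count (level_digraph n l) = level_count n l.
Proof.
have sarcE (x y : 'I_n) : sarc (level_digraph n l) x y = (l y < l x)%N.
  by rewrite /sarc !inE /= -leqNgt andb_idr // => /ltnW.
have indepE (x y : 'I_n) : indep (level_digraph n l) x y = (l x == l y).
  by rewrite /indep !inE /= -!leqNgt eqn_leq.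
rewrite /star_count /level_count.
rewrite big_mkord; apply: eq_bigr => x _; rewrite big_mkord; apply: eq_bigr => y _.
rewrite big_mkord; apply: eq_bigr => z _; rewrite big_mkord; apply: eq_bigr => c _.
rewrite /star4 /level_star !sarcE !indepE ![l x == _]eq_sym.
have [->|_] := eqVneq (l y) (l x); last by rewrite !andbF.
have [->|_] := eqVneq (l z) (l x); last by rewrite !andbF.
by rewrite ?eqxx !andbT ?andbb.
Qed.

(** One step of the iteration: the first [m] vertices keep their own construction, raised above a
    new bottom level that holds the others. *)
Definition push_level m l (i : nat) : nat := if (i < m)%N then (l i).+1 else 0%N.

(** Split by the first leaf. If it is among the first [m] vertices, keep the quadruples that lie
    wholly there, where raising all levels changes nothing. Otherwise take all three leaves in the
    bottom level and any of the first [m] vertices as centre. *)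
Lemma level_count_push n m l : (m <= n)%N ->
  ((n - m) ^ 3 * m + level_count m l <= level_count n (push_level m l))%N.
Proof.
move=> mn; set l' := push_level m l.
have cut (F : nat -> nat) : (\sum_(0 <= x < n) F x =
    \sum_(0 <= x < m) F x + \sum_(m <= x < n) F x)%N by rewrite (big_cat_nat (leq0n m) mn).
have cutl F : (\sum_(0 <= x < m) F x <= \sum_(0 <= x < n) F x)%N.
  by rewrite cut leq_addr.
have cutr F : (\sum_(m <= x < n) F x <= \sum_(0 <= x < n) F x)%N.
  by rewrite cut leq_addl.
rewrite {2}/level_count cut addnC; apply: leq_add.
  rewrite /level_count.
  apply: leq_sum_nat => x /= xm; apply: leq_trans (cutl _); apply: leq_sum_nat => y /= ym.
  apply: leq_trans (cutl _); apply: leq_sum_nat => z /= zm.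
  apply: leq_trans (cutl _); apply: leq_sum_nat => c /= cm.
  by rewrite /level_star /l' /push_level xm ym zm cm ltnS !eqSS.
have -> : ((n - m) ^ 3 * m = \sum_(m <= x < n) \sum_(m <= y < n) \sum_(m <= z < n)
    \sum_(0 <= c < m) 1)%N by rewrite !sum_nat_const_nat subn0 muln1 !expnS expn0 muln1 !mulnA.
apply: leq_sum_nat => x /andP[xm _]; apply: leq_trans (cutr _).
apply: leq_sum_nat => y /andP[ym _]; apply: leq_trans (cutr _).
apply: leq_sum_nat => z /andP[zm _]; apply: leq_trans (cutl _).
apply: leq_sum_nat => c /= cm.
by rewrite /level_star /l' /push_level cm !ltnNge xm ym zm.
Qed.

End LevelDigraph.

(** * The cubic and the optimal constant *)

(** The solution [K] of [K = p * (1 - p) ^+ 3 + K * p ^+ 4], the density of quadruples in the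
    iterated construction. With six quadruples per star and about [n ^ 4 / 24] vertex sets, the
    density of stars is [4 * K]. *)
Definition star_opt (R : realFieldType) (p : R) : R :=
  p * (1 - p) ^+ 3 / (1 - p ^+ 4).

Section Optimum.
Variables (R : realType) (p : R).
Hypothesis p_root : 3 * p ^+ 3 + 3 * p ^+ 2 + 3 * p - 1 = 0.

Let p_gt0 : 0 < p.
Proof.
rewrite ltNge; apply/negP => p0.
have h : 0 <= p ^+ 2 + p + 1 by have := sqr_ge0 (p + 1 / 2); lra.
have := mulr_le0_ge0 p0 h; have := p_root; lra.
Qed.

Let p_le : p <= 1 / 3.
Proof.
have := exprn_gt0 2 p_gt0; have := exprn_gt0 3 p_gt0; have := p_root; lra.
Qed.

Local Notation K := (star_opt p).

(* The equation for [p] says that [1 + p + p^2 + p^3 = 4/3]. *)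
Let KE : K = 3 / 4 * p * (1 - p) ^+ 2.
Proof.
rewrite /star_opt; have p0 := p_gt0; have p1 := p_le.
have e : 1 - p ^+ 4 = (1 - p) * (4 / 3).
  have -> : 4 / 3 = 1 + p + p ^+ 2 + p ^+ 3 by have := p_root; lra.
  by ring.
have q0 : 1 - p != 0 by apply: lt0r_neq0; lra.
by rewrite e; field.
Qed.

(* [K * (1 + q + q^2 + q^3) - q * (1 - q)^2] has a double root at [q = p]; the
   remaining linear factor takes the values [K / p^2] at 0 and [3 * p] at 1. *)
Lemma optimum_le (q : R) : 0 <= q <= 1 -> q * (1 - q) ^+ 3 + K * q ^+ 4 <= K.
Proof.
move=> /andP[q0 q1]; have p0 := p_gt0; have p1 := p_le.
rewrite KE -subr_ge0.
(* This is [K / p], the value at 0 of the linear factor multiplied by [p]. *)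
pose B := 3 / 4 * (1 - p) ^+ 2.
have -> : 3 / 4 * p * (1 - p) ^+ 2
    - (q * (1 - q) ^+ 3 + 3 / 4 * p * (1 - p) ^+ 2 * q ^+ 4) =
  (1 - q) * ((q - p) ^+ 2 * (B * (1 - q) + 3 * p ^+ 2 * q)) / p.
  rewrite -[LHS](mulfK (lt0r_neq0 p0)); congr (_ / _); apply/eqP.
  rewrite -subr_eq0; apply/eqP.
  (* The two sides, multiplied by [p], differ by an explicit multiple of the cubic in [p]. *)
  transitivity ((1 - q) * (- (p / 2) * q + (p / 4 + 3 / 4) * q ^+ 2
    + (p / 4 - 3 / 4) * q ^+ 3) * (3 * p ^+ 3 + 3 * p ^+ 2 + 3 * p - 1)).
    by rewrite /B; field.
  by rewrite p_root mulr0.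
rewrite divr_ge0 ?(ltW p0) // mulr_ge0 ?subr_ge0 // mulr_ge0 ?sqr_ge0 //.
rewrite addr_ge0 //; apply: mulr_ge0; rewrite ?subr_ge0 //.
  by rewrite mulr_ge0 ?sqr_ge0 //; lra.
by rewrite mulr_ge0 ?sqr_ge0 //; lra.
Qed.

(** Strong induction: iterate on the first [m] vertices, [m] being [p * n] rounded down. The main
    terms reproduce [K * n ^ 4] by the equation that defines [K]; only errors of order [n ^ 3]
    remain. *)
Lemma level_count_ge (n : nat) :
  exists l, K * n%:R ^+ 4 - 2 * n%:R ^+ 3 <= (level_count n l)%:R.
Proof.
have p0 := p_gt0; have p1 := p_le.
elim/ltn_ind: n => -[|n] IH.
  by exists (fun=> 0%N); rewrite /level_count big_nil !expr0n !mulr0 subr0.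
set m := Num.truncn (p * n.+1%:R).
set N : R := n.+1%:R; have N0 : 0 < N by rewrite ltr0n.
have t0 : 0 <= p * N by rewrite mulr_ge0 ?ltW.
have /andP[m_le m_gt] := truncn_itv t0; rewrite -/m -natr1 in m_le m_gt.
have mn : (m < n.+1)%N
  by rewrite -(ltr_nat R) -/N; have := ler_wpM2r (ltW N0) p1; lra.
have [l hl] := IH m mn; exists (push_level m l).
have := level_count_push l (ltnW mn); rewrite -(ler_nat R) natrD natrM natrX natrB ?(ltnW mn) // -/N.
apply: le_trans.
set M : R := m%:R in hl m_le m_gt *.
have M0 : 0 <= M by rewrite ler0n.
have K0 : 0 <= K by rewrite KE mulr_ge0 ?sqr_ge0 //; lra.
have K1 : K <= 1.
  have q2 : (1 - p) ^+ 2 <= 1 by rewrite exprn_ile1; lra.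
  by rewrite KE; have := ler_wpM2l (ltW p0) q2; lra.
have Kp : K = p * (1 - p) ^+ 3 + K * p ^+ 4.
  rewrite /star_opt; field; rewrite subr_eq0 eq_sym lt_eqF // exprn_ilt1 //; lra.
have h1 : ((1 - p) * N) ^+ 3 * (p * N - 1) <= (N - M) ^+ 3 * M.
  have qN : 0 <= (1 - p) * N by rewrite mulr_ge0 ?ltW //; lra.
  have h : ((1 - p) * N) ^+ 3 <= (N - M) ^+ 3.
    by apply: lerXn2r; rewrite ?nnegrE; lra.
  apply: (@le_trans _ _ (((1 - p) * N) ^+ 3 * M)).
    by rewrite ler_wpM2l ?exprn_ge0 //; lra.
  by rewrite ler_wpM2r.
(* For [t = p * N] at least 1 this follows from [t - 1 < M]; for smaller [t] the left side is at
   most 0. *)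
have h2 : (p * N) ^+ 4 - 4 * (p * N) ^+ 3 <= M ^+ 4.
  set t := p * N in t0 m_gt *.
  have [t1|t1] := lerP 1 t.
    have : (t - 1) ^+ 4 <= M ^+ 4 by apply: lerXn2r; rewrite ?nnegrE; lra.
    apply: le_trans; rewrite -subr_ge0.
    have -> : (t - 1) ^+ 4 - (t ^+ 4 - 4 * t ^+ 3) = 2 * (t - 1) ^+ 2 + 4 * t ^+ 2 - 1 by ring.
    by have := exprn_ege1 2 t1; have := sqr_ge0 (t - 1); lra.
  apply: (@le_trans _ _ 0); last exact: exprn_ge0.
  have -> : t ^+ 4 - 4 * t ^+ 3 = t ^+ 3 * (t - 4) by ring.
  by rewrite mulr_ge0_le0 ?exprn_ge0 //; lra.
have h3 : M ^+ 3 <= (p * N) ^+ 3 by apply: lerXn2r; rewrite ?nnegrE.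
have p3 : p ^+ 3 <= 1 / 27.
  have -> : 1 / 27 = (1 / 3) ^+ 3 :> R by field.
  by apply: lerXn2r; rewrite ?nnegrE //; lra.
have h4 := ler_wpM2l K0 h2.
have N3 : 0 <= N ^+ 3 by rewrite exprn_ge0 ?ltW.
have q3 : (1 - p) ^+ 3 <= 1 by rewrite exprn_ile1; lra.
have p30 : 0 <= p ^+ 3 by rewrite exprn_ge0 ?ltW.
(* Error budget in units of [N ^+ 3]: the first two terms come from rounding in [h1] and [h2], the
   third is inherited from the inner construction. The constant 2 of the statement absorbs all
   three. *)
have c1 : (1 - p) ^+ 3 + 4 * K * p ^+ 3 + 2 * p ^+ 3 <= 2.
  by have := ler_wpM2r p30 K1; lra.
have := ler_wpM2r N3 c1.
have e : K * N ^+ 4 = p * (1 - p) ^+ 3 * N ^+ 4 + K * p ^+ 4 * N ^+ 4.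
  by rewrite {1}Kp; ring.
rewrite e; move: h1 h3 h4 hl; rewrite !exprMn; lra.
Qed.

End Optimum.

(** * Density bounds and the limit *)

Lemma bin4E (R : comRingType) (n : nat) : (2 < n)%N ->
  24 * 'C(n, 4)%:R = n%:R * (n%:R - 1) * (n%:R - 2) * (n%:R - 3) :> R.
Proof.
case: n => [|[|[|n]]] // _.
have -> : 24 = (4`!)%:R :> R by [].
by rewrite -natrM mulnC bin_ffact !ffactnSr ffactn0 mul1n !natrM !natrB // ?subn0; ring.
Qed.

Lemma max_density_outstar4_bounds (R : realType) (p : R) (n : nat) :
    3 * p ^+ 3 + 3 * p ^+ 2 + 3 * p - 1 = 0 -> (12 < n)%N ->
  4 * star_opt p - 40 * harmonic n <= max_density R outstar4 n
    <= 4 * star_opt p + 12 * (4 * star_opt p) * harmonic n.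
Proof.
move=> p_root n12; rewrite /max_density card_ord.
set M := (\max_(D : digraph 'I_n) _)%N; set K := star_opt p; set N : R := n%:R.
have N13 : 13 <= N by rewrite /N ler_nat.
have K0 : 0 <= K.
  by have := optimum_le p_root (q := 0); rewrite !lexx ler01 => /(_ isT); rewrite -/K; lra.
have upper : 6 * M%:R <= K * N ^+ 4.
  have [|D eM] := @bigop.eq_bigmax (digraph 'I_n) (num_induced outstar4).
    by apply/card_gt0P; exists (level_digraph n id).
  rewrite /M eM; have := num_induced_le_star_count D; rewrite -(ler_nat R) natrM => /le_trans; apply.
  rewrite -star_weight1.
  have := @star_weight_le R _ (sarc D) (indep D) K (optimum_le p_root)
    (@sarc_anti _ D) (@indepxx _ D) (@sarc_indep _ D) (@indep_sym _ D) (fun=> 1).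
  by rewrite sumr_const card_ord => /(_ (fun=> ler01)).
(* The loss of 5 is 2 from the construction plus 3 from repeated leaves. *)
have lower : K * N ^+ 4 - 5 * N ^+ 3 <= 6 * M%:R.
  have [l hl] := level_count_ge p_root n.
  have := star_count_le (level_digraph n l).
  rewrite star_count_level card_ord -(ler_nat R) natrD (natrM _ 6) (natrM _ 3) natrX -/N.
  have : (num_induced outstar4 (level_digraph n l))%:R <= M%:R :> R.
    by rewrite ler_nat; apply: bigop.leq_bigmax.
  move: hl; rewrite -/N -/K; lra.
have C0 : 0 < 'C(n, 4)%:R :> R by rewrite ltr0n bin_gt0 (leq_trans _ n12).
have CE := @bin4E R n (leq_trans _ n12); rewrite -/N in CE.
have hE : harmonic n = (N + 1)^-1 :> R by rewrite /harmonic /= -natr1.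
rewrite hE.
have N1 : 0 < N + 1 by lra.
have N0 : 0 < N by lra.
have N3 : 0 < N ^+ 3 by rewrite exprn_gt0.
apply/andP; split; last first.
  rewrite ler_pdivrMr // -(ler_pM2l (x := 24)) // mulrCA CE //.
  have -> : 4 * K + 12 * (4 * K) / (N + 1) = 4 * K * ((N + 13) / (N + 1)).
    by field; apply: lt0r_neq0.
  apply: (@le_trans _ _ (4 * K * N ^+ 4)); first by lra.
  rewrite -[leRHS]mulrA ler_wpM2l //; first by lra.
  (* The factor [1 + 12 / (N + 1)] outweighs the ratio of [N ^+ 4] to the falling factorial;
     [12 < n] makes [6 * N - 67] nonnegative. *)
  rewrite mulrAC ler_pdivlMr // -subr_ge0.
  have -> : (N + 13) * (N * (N - 1) * (N - 2) * (N - 3)) - N ^+ 4 * (N + 1) =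
    N * (N ^+ 2 * (6 * N - 67) + 137 * N - 78) by ring.
  have h : 0 <= N ^+ 2 * (6 * N - 67) by rewrite mulr_ge0 ?sqr_ge0 //; lra.
  by rewrite mulr_ge0 //; lra.
rewrite ler_pdivlMr //; set s := 4 * K - _.
(* Replacing the binomial coefficient by its upper bound [N ^+ 4 / 24] requires [s] to be
   nonnegative; otherwise the claim is trivial. *)
have [s0|/ltW s0] := lerP s 0.
  by apply: (@le_trans _ _ 0); rewrite ?ler0n // mulr_le0_ge0 ?(ltW C0).
have CN : 24 * 'C(n, 4)%:R <= N ^+ 4.
  rewrite CE // -subr_ge0.
  have -> : N ^+ 4 - N * (N - 1) * (N - 2) * (N - 3) = N * (6 * N * (N - 2) + N + 6).
    by ring.
  have h : 0 <= N * (N - 2) by rewrite mulr_ge0; lra.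
  by rewrite mulr_ge0 //; lra.
have := ler_wpM2l s0 CN.
have : s * N ^+ 4 <= 4 * K * N ^+ 4 - 20 * N ^+ 3.
  (* This is why 40, twice [4 * 5], suffices with [harmonic n = 1 / (n + 1)]. *)
  have h : N / (N + 1) >= 1 / 2 by rewrite ler_pdivlMr //; lra.
  have -> : s * N ^+ 4 = 4 * K * N ^+ 4 - 40 * (N ^+ 3 * (N / (N + 1))).
    by rewrite /s; field; apply: lt0r_neq0.
  by have := ler_wpM2l (ltW N3) h; lra.
lra.
Qed.

Lemma cubic_hornerE (R : realType) (p : R) :
  root (3 *: 'X^3 + 3 *: 'X^2 + 3 *: 'X - 1 : {poly R}) p =
    (3 * p ^+ 3 + 3 * p ^+ 2 + 3 * p - 1 == 0).
Proof. by rewrite /root !hornerE. Qed.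

(** The difference quotient of the cubic is [3 / 2] times a sum of three squares, which cannot all
    vanish: the last two force [p = q = -1], and then [q + p] is not 0. *)
Lemma cubic_root_inj (R : realType) (p q : R) :
    3 * p ^+ 3 + 3 * p ^+ 2 + 3 * p - 1 = 0 ->
    3 * q ^+ 3 + 3 * q ^+ 2 + 3 * q - 1 = 0 -> q = p.
Proof.
move=> rp rq; apply/eqP; rewrite -subr_eq0.
have : (q - p) * ((q + p) ^+ 2 + (q + 1) ^+ 2 + (p + 1) ^+ 2) = 0.
  have -> : (q - p) * ((q + p) ^+ 2 + (q + 1) ^+ 2 + (p + 1) ^+ 2) =
    2 / 3 * ((3 * q ^+ 3 + 3 * q ^+ 2 + 3 * q - 1)
             - (3 * p ^+ 3 + 3 * p ^+ 2 + 3 * p - 1)) by field.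
  by rewrite rp rq; ring.
move/eqP; rewrite mulf_eq0 => /orP[//|]; rewrite gt_eqF //.
have := sqr_ge0 (q + p); have := sqr_ge0 (q + 1); have := sqr_ge0 (p + 1).
have := sqr_ge0 (q + p + 1); have := sqr_ge0 (q + p - 1); nra.
Qed.

Local Open Scope classical_set_scope.

Theorem theorem3p6 (R : realType) :
  exists p : R,
    [/\ root (3 *: 'X^3 + 3 *: 'X^2 + 3 *: 'X - 1 : {poly R}) p,
        forall q : R,
          root (3 *: 'X^3 + 3 *: 'X^2 + 3 *: 'X - 1 : {poly R}) q -> q = p,
        cvg (max_density R outstar4 n @[n --> \oo]) &
        pi_induced R outstar4 = 4 * p * (1 - p) ^+ 3 / (1 - p ^+ 4)].
Proof.
(* The cubic goes from -1 at 0 to 8 at 1. *)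
have [||p _ rp] := @poly_ivt R (3 *: 'X^3 + 3 *: 'X^2 + 3 *: 'X - 1) 0 1.
- exact: ler01.
- by rewrite !hornerE ?expr0n ?expr1n /=; apply/andP; split; lra.
have p_root : 3 * p ^+ 3 + 3 * p ^+ 2 + 3 * p - 1 = 0.
  by apply/eqP; rewrite -cubic_hornerE.
have lim_density : max_density R outstar4 n @[n --> \oo] --> 4 * star_opt p.
  have lim_aff (c : R) : 4 * star_opt p + c * harmonic n @[n --> \oo] --> 4 * star_opt p.
    rewrite -[X in _ --> X]addr0 -[X in _ --> _ + X](mulr0 c).
    by apply: cvgD; [exact: cvg_cst|apply: cvgMr; exact: cvg_harmonic].
  apply: (squeeze_cvgr _ (lim_aff (-40)) (lim_aff (12 * (4 * star_opt p)))).
  near=> n; rewrite mulNr; apply: max_density_outstar4_bounds => //.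
  by near: n; exact: nbhs_infty_gt.
exists p; split => //.
- by move=> q; rewrite cubic_hornerE => /eqP; exact: cubic_root_inj.
- by apply/cvg_ex; exists (4 * star_opt p).
- by rewrite /pi_induced (cvg_lim _ lim_density) // /star_opt !mulrA.
Unshelve. all: by end_near.
Qed.
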